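(* Let $n\ge 3$, $e=\{1,n\}$ and $A\in\mathcal{S}_L(K_n-e)$. Then $A$ does not have the SSPWL if and only if it is of the form \[ A=\begin{bmatrix} (n-2)\alpha & -\alpha\mathbf 1_{n-2}^\top & 0\\ -\alpha\mathbf 1_{n-2} & B+2\alpha I_{n-2} & -\alpha\mathbf 1_{n-2}\\ 0 & -\alpha\mathbf 1_{n-2}^\top & (n-2)\alpha \end{bmatrix} \] where $B\in\mathcal{S}_L(K_{n-2})$ and $\alpha>0$. Furthermore, for $A$ of this form, \[ \operatorname{spec}(A)=\{0,(n-2)\alpha,n\alpha,\mu_2+2\alpha,\ldots,\mu_{n-2}+2\alpha\} \] where $\{0,\mu_2,\ldots,\mu_{n-2}\}=\operatorname{spec}(B)$.
   Context: For a finite simple graph $G$ on vertex set $\{1,\ldots,n\}$, $\mathcal{S}_L(G)$ denotes the set of weighted Laplacian matrices of $G$: all $n\times n$ real symmetric matrices $A=[a_{i,j}]$ with, for $i\ne j$, $a_{i,j}<0$ if $\{i,j\}\in E(G)$ and $a_{i,j}=0$ if $\{i,j\}\notin E(G)$, and with $a_{i,i}=-\sum_{k:\{k,i\}\in E(G)}a_{i,k}$ for all $i$. $K_n-e$ is the complete graph on $\{1,\ldots,n\}$ with the edge $e$ removed. $\mathbf 1_{n-2}$ is the all-ones vector of length $n-2$. Let $J$ be the $n\times n$ all-ones matrix and $H=I-\frac1n J$. A matrix $A\in\mathcal{S}_L(G)$ has the strong spectral property for weighted Laplacian matrices (SSPWL) if $X=O$ is the only real symmetric $n\times n$ matrix satisfying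 $A\circ X=I\circ X=O$ and $H(AX-XA)H=O$, where $\circ$ is the entrywise product. $\operatorname{spec}$ denotes the multiset of eigenvalues. *)

(* Defs.v *)
From mathcomp Require Import all_boot all_order all_algebra.
From mathcomp Require Import reals.

Set Implicit Arguments.
Unset Strict Implicit.
Unset Printing Implicit Defensive.

Import Order.TTheory GRing.Theory Num.Theory.
Local Open Scope ring_scope.

Record sgraph (n : nat) := SGraph {
  adj :> rel 'I_n;
  adj_sym : symmetric adj;
  adj_irr : irreflexive adj
}.

Section Graphs.
Variable n : nat.

Definition complete_rel : rel 'I_n := fun i j => i != j.

Lemma complete_sym : symmetric complete_rel.
Proof. by move=> i j; rewrite /complete_rel eq_sym. Qed.

Lemma complete_irr : irreflexive complete_rel.
Proof. by move=> i; rewrite /complete_rel eqxx. Qed.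

Definition complete_graph : sgraph n := SGraph complete_sym complete_irr.

Definition del_edge_rel (G : sgraph n) (e : {set 'I_n}) : rel 'I_n :=
  fun i j => G i j && ([set i; j] != e).

Lemma del_edge_sym G e : symmetric (del_edge_rel G e).
Proof. by move=> i j; rewrite /del_edge_rel adj_sym setUC. Qed.

Lemma del_edge_irr G e : irreflexive (del_edge_rel G e).
Proof. by move=> i; rewrite /del_edge_rel adj_irr. Qed.

Definition del_edge (G : sgraph n) (e : {set 'I_n}) : sgraph n :=
  SGraph (del_edge_sym G e) (del_edge_irr G e).

(* Vertices 1, ..., n are encoded as 0, ..., n.-1 in 'I_n, so this is {1, n}. *)
Definition first_last : {set 'I_n} :=
  [set i : 'I_n | (i == 0 :> nat) || (i == n.-1 :> nat)].

End Graphs.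

Section Matrices.
Variable R : realType.

Definition weighted_laplacian n (G : sgraph n) (A : 'M[R]_n) : Prop :=
  [/\ A^T = A,
      forall i j, i != j -> G i j -> A i j < 0,
      forall i j, i != j -> ~~ G i j -> A i j = 0
    & forall i, A i i = - \sum_(k | G k i) A i k].

Definition hadamard n (A B : 'M[R]_n) : 'M[R]_n := map2_mx *%R A B.

Definition centering_mx n : 'M[R]_n := 1%:M - n%:R^-1 *: const_mx 1.

Definition has_SSPWL n (A : 'M[R]_n) : Prop :=
  forall X : 'M[R]_n, X^T = X ->
    hadamard A X = 0 -> hadamard 1%:M X = 0 ->
    centering_mx n *m (A *m X - X *m A) *m centering_mx n = 0 ->
    X = 0.

(* The sequence s lists the eigenvalues with algebraic multiplicity, all of
   them in R; this determines s up to permutation. *)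
Definition is_spec n (A : 'M[R]_n) (s : seq R) : Prop :=
  char_poly A = \prod_(x <- s) ('X - x%:P).

Definition bordered_block m (B : 'M[R]_m) (alpha : R) : 'M[R]_(1 + (m + 1)) :=
  block_mx (m%:R * alpha)%:M
           (row_mx (- alpha *: const_mx 1) 0)
           (col_mx (- alpha *: const_mx 1) 0)
           (block_mx (B + (2 * alpha)%:M) (- alpha *: const_mx 1)
                     (- alpha *: const_mx 1) (m%:R * alpha)%:M).

Lemma bordered_dim n : (3 <= n)%N -> (1 + ((n - 2) + 1) = n)%N.
Proof. by case: n => [|[|n]] // _; rewrite subSS subSS subn0 addn1. Qed.

Definition bordered_mx n (n_ge3 : (3 <= n)%N) (B : 'M[R]_(n - 2)) (alpha : R) :
    'M[R]_n :=
  castmx (bordered_dim n_ge3, bordered_dim n_ge3) (bordered_block B alpha).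

End Matrices.

(* Main.v *)
Require Import Defs.
From mathcomp Require Import all_boot all_order all_algebra.
From mathcomp Require Import reals.
From mathcomp Require Import complex ring lra.

(** Why the theorem holds. A matrix [X] orthogonal to [A] and to the identity
    entrywise is supported on the missing edge, hence is a multiple [x N] of its
    adjacency matrix [N] (called [edge_mx] below). So the strong spectral property
    fails exactly when the single commutator [M = A N - N A] vanishes on the
    orthogonal complement of the all-ones vector. This says that all second
    differences [M i j - M i' j - M i j' + M i' j'] are zero, and the entries of
    [M] are built from the two rows of [A] at the ends of the missing edge. As
    the row sums of [A] vanish, these equations say that the other vertices are
    all joined to both ends with one and the same weight [alpha]
    ([twin_of_not_SSPWL]), and conversely ([not_SSPWL_of_twin]). Written in
    blocks, this is the displayed form of [A] ([bordered_of_twin]).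

    For the spectrum, the tool is Brauer's theorem ([char_poly_rank1_update]):
    adding [u w] to a matrix with eigenvector [u] only moves the eigenvalue of
    [u], by [w u]. Taking for [u] the all-ones vector, one such update makes the
    bordered matrix block triangular, and a second one turns its middle block into
    [B + 2 alpha]; comparing characteristic polynomials
    ([char_poly_bordered_block]) gives the eigenvalues. That [B] has all its
    eigenvalues in [R] is the spectral theorem for symmetric matrices, obtained
    from the Hermitian case over [R[i]]. *)

Set Implicit Arguments.
Unset Strict Implicit.
Unset Printing Implicit Defensive.

Import Order.TTheory GRing.Theory Num.Theory.
Local Open Scope ring_scope.

(** * Rank-one updates of characteristic polynomials *)

(** The bordered matrix [1, w; u, t] is triangularized in two ways: clearing [w]
    leaves [t - u w] in the lower block, clearing [u] leaves [t - w u] in the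
    corner. The factor [t] on the left replaces an exponent [n.-1] on the right. *)
Lemma det_scalar_sub_rank1 (R : comNzRingType) n (t : R)
    (u : 'cV[R]_n) (w : 'rV[R]_n) :
  t * \det (t%:M - u *m w) = t ^+ n * (t - (w *m u) 0 0).
Proof.
set P : 'M_(1 + n) := block_mx 1%:M w u t%:M.
have det_clear_w : \det P = \det (t%:M - u *m w).
  have := det_mulmx P (block_mx 1%:M (- w) 0 1%:M).
  rewrite mulmx_block !mulmx0 !mulmx1 !addr0 mul1mx mulmxN addNr.
  by rewrite det_lblock det_ublock !det_scalar !expr1n !mul1r mulr1 addrC.
have := det_mulmx P (block_mx t%:M 0 (- u) 1%:M).
rewrite mulmx_block !mulmx0 !mulmx1 mul1mx !mulmxN !add0r.
rewrite mul_mx_scalar mul_scalar_mx subrr det_ublock det_lblock.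
rewrite !det_scalar expr1n mulr1 det_clear_w det_mx11 !mxE eqxx mulr1n => eq_det.
by rewrite mulrC -[t in LHS]expr1 -eq_det mulrC.
Qed.

(** Brauer's theorem. Since [u] is an eigenvector, [X - A - u w] agrees, up to
    the factor [X - lambda], with the product of [X - A] and
    [(X - lambda) - u w]; the determinant of the second factor is explicit. *)
Lemma char_poly_rank1_update (R : idomainType) n (A : 'M[R]_n) (lambda : R)
    (u : 'cV[R]_n) (w : 'rV[R]_n) :
  A *m u = lambda *: u ->
  char_poly (A + u *m w) * ('X - lambda%:P) =
  char_poly A * ('X - (lambda + (w *m u) 0 0)%:P).
Proof.
move=> Au; set t := 'X - lambda%:P.
have tX_neq0 : t ^+ n != 0 by rewrite expf_neq0 // polyXsubC_eq0.
pose uP := map_mx polyC u; pose wP := map_mx polyC w.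
have factor : char_poly_mx A *m (t%:M - uP *m wP)
            = t *: char_poly_mx (A + u *m w).
  rewrite mulmxBr mul_mx_scalar mulmxA.
  have -> : char_poly_mx A *m uP = t *: uP.
    rewrite mulmxBl mul_scalar_mx -map_mxM /= Au scalerBl.
    by congr (_ - _); apply/matrixP => i j; rewrite !mxE polyCM.
  rewrite -scalemxAl -scalerBr -map_mxM; congr (_ *: _).
  by rewrite /char_poly_mx map_mxD opprD addrA.
have := congr1 (fun M => t * \det M) factor.
rewrite det_mulmx mulrCA det_scalar_sub_rank1 detZ -!/(char_poly _) => eq_det.
apply: (mulfI tX_neq0).
transitivity (t * (t ^+ n * char_poly (A + u *m w))).
  by rewrite [_ * t]mulrC mulrCA.
rewrite -eq_det mulrCA; congr (_ * (_ * _)).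
by rewrite -map_mxM mxE polyCD opprD addrA.
Qed.

Lemma char_polyD_scalar (R : comNzRingType) n (A : 'M[R]_n) (c : R) :
  char_poly (A + c%:M) = char_poly A \Po ('X - c%:P).
Proof.
rewrite /char_poly -det_map_mx; congr (\det _); apply/matrixP => i j.
rewrite !mxE /= comp_polyB comp_polyC polyCD.
by case: eqP => _; rewrite ?comp_polyX ?comp_poly0 ?polyC0 ?addr0 //
  [_ + c%:P]addrC opprD addrA.
Qed.

Lemma char_poly_ublock (R : comNzRingType) m n (A : 'M[R]_m) (B : 'M[R]_(m, n))
    (D : 'M[R]_n) :
  char_poly (block_mx A B 0 D) = char_poly A * char_poly D.
Proof.
rewrite /char_poly /char_poly_mx scalar_mx_block map_block_mx map_mx0.
by rewrite opp_block_mx add_block_mx oppr0 addr0 det_ublock.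
Qed.

Lemma char_poly_lblock (R : comNzRingType) m n (A : 'M[R]_m) (C : 'M[R]_(n, m))
    (D : 'M[R]_n) :
  char_poly (block_mx A 0 C D) = char_poly A * char_poly D.
Proof.
rewrite /char_poly /char_poly_mx scalar_mx_block map_block_mx map_mx0.
by rewrite opp_block_mx add_block_mx oppr0 addr0 det_lblock.
Qed.

Lemma char_poly_scalar1 (R : comNzRingType) (a : R) :
  char_poly (a%:M : 'M_1) = 'X - a%:P.
Proof. by rewrite /char_poly det_mx11 !mxE eqxx !mulr1n. Qed.

Lemma char_poly_similar (F : fieldType) n (P A : 'M[F]_n) :
  P \in unitmx -> char_poly (invmx P *m A *m P) = char_poly A.
Proof.
move=> Punit; rewrite /char_poly.
pose PX := map_mx polyC P; pose QX := map_mx polyC (invmx P).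
have QPX : QX *m PX = 1%:M by rewrite -map_mxM mulVmx // map_mx1.
have -> : char_poly_mx (invmx P *m A *m P) = QX *m char_poly_mx A *m PX.
  rewrite mulmxBr mulmxBl mul_mx_scalar -scalemxAl QPX scalemx1.
  by rewrite -!map_mxM.
by rewrite !det_mulmx mulrAC -det_mulmx QPX det1 mul1r.
Qed.

(** * Spectra of symmetric matrices and of Laplacians *)

(** Over the complex numbers the matrix is Hermitian, hence unitarily similar to
    a real diagonal matrix; the factorization of the characteristic polynomial
    then descends because the embedding of [R] is injective. *)
Lemma symmetric_spec (R : rcfType) n (B : 'M[R]_n) :
  B^T = B -> exists s : n.-tuple R, char_poly B = \prod_(x <- s) ('X - x%:P).
Proof.
move=> Bsym; pose BC := map_mx (real_complex R) B.
have BC_herm : BC \is hermsymmx.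
  apply: realsym_hermsym.
    by apply/is_hermitianmxP; rewrite expr0 scale1r map_mx_id // map_trmx Bsym.
  by apply/mxOverP => i j; rewrite mxE; apply/complex_realP; exists (B i j).
have /orthomx_spectralP BC_diag := hermitian_normalmx BC_herm.
have /mxOverP d_real := hermitian_spectral_diag_real BC_herm.
exists [tuple complex.Re (spectral_diag BC 0 i) | i < n].
apply: (map_poly_inj (real_complex R)).
rewrite map_char_poly -/BC {1}BC_diag char_poly_similar ?spectral_unit //.
rewrite char_poly_trig ?diag_mx_is_trig // rmorph_prod /= big_map big_enum /=.
apply: eq_bigr => i _.
by rewrite rmorphB /= map_polyX map_polyC /= !mxE eqxx mulr1n RRe_real.
Qed.

Lemma laplacian_row_sum (R : realType) n (G : sgraph n) (A : 'M[R]_n) i :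
  weighted_laplacian G A -> \sum_j A i j = 0.
Proof.
case=> _ _ nonedge diag; rewrite (bigD1 i) //= diag [X in _ + X]big_mkcond.
rewrite [X in - X + _]big_mkcond -sumrN -big_split big1 //= => j _.
case: eqVneq => [->|ji]; first by rewrite adj_irr addr0 oppr0.
case: ifPn => [_|nGji]; rewrite ?addNr // oppr0 add0r.
by apply: nonedge; [rewrite eq_sym | rewrite adj_sym].
Qed.

Lemma laplacian_of_row_sums (R : realType) n (A : 'M[R]_n) :
  A^T = A -> (forall i j, i != j -> A i j < 0) -> (forall i, \sum_j A i j = 0) ->
  weighted_laplacian (complete_graph n) A.
Proof.
move=> Asym Aneg rows; split=> // [i j ij _|i j ij|i]; first exact: Aneg.
  by rewrite /= /complete_rel ij.
by apply/eqP; rewrite -addr_eq0 -[X in _ == X](rows i) [X in _ == X](bigD1 i).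
Qed.

Lemma laplacian_ones (R : realType) n (G : sgraph n) (A : 'M[R]_n) :
  weighted_laplacian G A -> A *m const_mx 1 = 0 :> 'cV_n.
Proof.
move=> Alap; apply/matrixP => i j; rewrite !mxE -[RHS](laplacian_row_sum i Alap).
by apply: eq_bigr => k _; rewrite mxE mulr1.
Qed.

(** The all-ones vector is in the kernel, so [0] can be moved to the head of the
    list of eigenvalues. *)
Lemma laplacian_spec (R : realType) m k (G : sgraph k) (B : 'M[R]_k) :
  m.+1 = k -> weighted_laplacian G B ->
  exists mu : m.-tuple R, is_spec B (0 :: mu).
Proof.
move=> mk Blap; have [Bsym _ _ _] := Blap.
have [s specB] := symmetric_spec Bsym.
have s0 : 0 \in tval s.
  rewrite -root_prod_XsubC -specB -eigenvalue_root_char.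
  apply/eigenvalueP; exists (const_mx 1).
    apply: trmx_inj; rewrite trmx_mul Bsym trmx_const (laplacian_ones Blap).
    by rewrite scale0r trmx0.
  apply/eqP => /matrixP/(_ 0); subst k => /(_ ord0)/eqP.
  by rewrite !mxE oner_eq0.
have size_rem : size (rem 0 s) == m by rewrite size_rem // size_tuple -mk.
exists (Tuple size_rem); rewrite /is_spec specB /=.
exact/perm_big/perm_to_rem.
Qed.

(** * The spectrum of the bordered matrix *)

Lemma mul_const_mx (R : pzRingType) m n p (a b : R) :
  (const_mx a : 'M_(m, n)) *m const_mx b =
  const_mx ((a * b) *+ n) :> 'M_(m, p).
Proof.
apply/matrixP => i j; rewrite !mxE (eq_bigr (fun=> a * b)).
  by rewrite sumr_const card_ord.
by move=> k _; rewrite !mxE.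
Qed.

Lemma bordered_block_ones (R : realType) k (B : 'M[R]_k) (alpha : R) :
  B *m const_mx 1 = 0 :> 'cV_k ->
  bordered_block B alpha *m const_mx 1 = 0 :> 'cV_(1 + (k + 1)).
Proof.
move=> B1.
rewrite -(col_mx_const 1 _ 1) -(col_mx_const k _ 1) /bordered_block.
rewrite mul_block_col mul_row_col mul_col_mx mul_block_col.
rewrite mulmxDl B1 -!scalemxAl !mul_scalar_mx !mul0mx !add0r !addr0.
rewrite !mul_const_mx add_col_mx !mulr1.
apply/eqP; rewrite !col_mx_eq0; apply/and3P; split; apply/eqP/matrixP => i j;
  rewrite !mxE ?mulr_natr; ring.
Qed.

(** Adding the vector [w] below to every row cancels the border entries of the
    first and last rows, which makes the matrix block triangular. This update is
    the product of the all-ones vector, a null vector of the matrix, with [w], so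
    it moves a single eigenvalue. Removing the constant matrix [J] that it leaves
    in the middle block is an update of the same kind; it is where the factor
    ['X - 2 alpha] on the left comes from. *)
Lemma char_poly_bordered_block (R : realType) k (B : 'M[R]_k) (alpha : R) :
  B *m const_mx 1 = 0 :> 'cV_k ->
  char_poly (bordered_block B alpha) * ('X - (2 * alpha)%:P) =
  char_poly (B + (2 * alpha)%:M) *
    ('X * ('X - (k%:R * alpha)%:P) * ('X - (k.+2%:R * alpha)%:P)).
Proof.
move=> B1; set A := bordered_block B alpha.
set q := 'X - (k%:R * alpha)%:P.
have q_neq0 : q != 0 by rewrite polyXsubC_eq0.
pose w : 'rV[R]_(1 + (k + 1)) := row_mx 0 (row_mx (const_mx alpha) 0).
pose D := B + (2 * alpha)%:M.
pose J := (const_mx 1 : 'cV_k) *m (const_mx alpha : 'rV_k).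
have Auw : A + (const_mx 1 : 'cV_(1 + (k + 1))) *m w =
   block_mx (k%:R * alpha)%:M 0 (col_mx (- alpha *: const_mx 1) 0)
     (block_mx (D + J) (- alpha *: const_mx 1) 0 (k%:R * alpha)%:M).
  have -> : (const_mx 1 : 'cV_(1 + (k + 1))) *m w =
      block_mx 0 (row_mx (const_mx alpha) 0) 0
        (block_mx J 0 (const_mx alpha) 0).
    rewrite -[const_mx 1 in LHS](@col_mx_const _ 1 (k + 1) 1) mul_col_row.
    rewrite !mulmx0 -[X in block_mx _ _ _ (X *m _)](@col_mx_const _ k 1 1).
    by rewrite mul_mx_row mul_col_row !mulmx0 /J !mul_const_mx mul1r.
  rewrite add_block_mx add_row_mx add_block_mx !addr0.
  have cancel m n : - alpha *: const_mx 1 + const_mx alpha = 0 :> 'M_(m, n).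
    by apply/matrixP => i j; rewrite !mxE; ring.
  by rewrite !cancel row_mx0.
have A_split : char_poly A * q = q * (char_poly (D + J) * q) * 'X.
  have := @char_poly_rank1_update _ _ A 0 (const_mx 1) w.
  rewrite bordered_block_ones // scale0r subr0 add0r => /(_ erefl).
  rewrite Auw char_poly_lblock char_poly_ublock !char_poly_scalar1 => ->.
  congr (_ * ('X - _%:P)).
  rewrite -(@col_mx_const _ 1 (k + 1)) -(@col_mx_const _ k 1 1) !mul_row_col.
  (* With zero blocks as constant matrices, one product formula does it all. *)
  rewrite -[0 in X in X + _]/(const_mx 0) -[0 in X in _ + X]/(const_mx 0).
  by rewrite !mul_const_mx !mul0r !mul0rn mulr1 !mxE add0r addr0 mulr_natl.
have D_split : char_poly (D + J) * ('X - (2 * alpha)%:P) =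
    char_poly D * ('X - (k.+2%:R * alpha)%:P).
  have D1 : D *m const_mx 1 = (2 * alpha) *: const_mx 1 :> 'cV_k.
    by rewrite mulmxDl B1 add0r mul_scalar_mx.
  rewrite (char_poly_rank1_update _ D1).
  congr (_ * ('X - _%:P)); rewrite mul_const_mx mxE mulr1 -mulr_natl; ring.
apply: (mulfI q_neq0).
rewrite mulrA [q * _]mulrC A_split.
transitivity (q * q * 'X * (char_poly (D + J) * ('X - (2 * alpha)%:P))).
  by ring.
by rewrite D_split; ring.
Qed.

Lemma spec_bordered_block (R : realType) k (B : 'M[R]_k) (alpha : R) mu :
  B *m const_mx 1 = 0 :> 'cV_k -> is_spec B (0 :: mu) ->
  is_spec (bordered_block B alpha)
    [:: 0, k%:R * alpha, k.+2%:R * alpha & [seq m + 2 * alpha | m <- mu]].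
Proof.
rewrite /is_spec => B1 specB.
have p_neq0 : 'X - (2 * alpha)%:P != 0 by rewrite polyXsubC_eq0.
apply: (mulIf p_neq0); rewrite char_poly_bordered_block // char_polyD_scalar.
rewrite specB !big_cons comp_polyM comp_polyB comp_polyX comp_polyC.
rewrite rmorph_prod /= big_map.
rewrite (eq_bigr (fun x => 'X - (x + 2 * alpha)%:P)) => [|x _]; last first.
  by rewrite comp_polyB comp_polyX comp_polyC polyCD opprD addrA addrAC.
rewrite !polyC0; ring.
Qed.

(** * The centering matrix *)

Lemma centering_ones (R : realType) n : (0 < n)%N ->
  centering_mx R n *m const_mx 1 = 0 :> 'cV_n.
Proof.
move=> n_gt0; rewrite mulmxBl mul1mx -scalemxAl mul_const_mx mulr1.
apply/matrixP => i j; rewrite !mxE mulVf ?subrr //.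
by rewrite pnatr_eq0 -lt0n.
Qed.

Lemma centering_tr (R : realType) n : (centering_mx R n)^T = centering_mx R n.
Proof. by rewrite linearB linearZ /= trmx1 trmx_const. Qed.

(** Differences of two basis vectors are fixed by the centering matrix, so
    compressing [M] to the complement of the all-ones vector loses none of the
    second differences of its entries. *)
Lemma contrast_of_centering0 (R : realType) n (M : 'M[R]_n) i i' j j' :
  centering_mx R n *m M *m centering_mx R n = 0 ->
  M i j - M i' j = M i j' - M i' j'.
Proof.
move=> HMH0; pose d (a b : 'I_n) : 'rV[R]_n := delta_mx 0 a - delta_mx 0 b.
have dH a b : d a b *m centering_mx R n = d a b.
  rewrite mulmxBr mulmx1 -scalemxAr mulmxBl -!rowE !row_const subrr.
  by rewrite scaler0 subr0.
have Hd a b : centering_mx R n *m (d a b)^T = (d a b)^T.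
  by rewrite -[LHS]trmxK trmx_mul trmxK centering_tr dH.
have : d i i' *m M *m (d j j')^T = 0.
  rewrite -(dH i i') -(Hd j j') !mulmxA -(mulmxA (d i i')) -(mulmxA (d i i')).
  by rewrite HMH0 mulmx0 mul0mx.
move/matrixP/(_ 0 0).
rewrite linearB /= !trmx_delta mulmxBr -!colE mulmxBl -!rowE !mxE => /eqP.
by rewrite subr_eq0 => /eqP.
Qed.

(** * The strong spectral property for a complete graph minus an edge *)

Definition edge_mx (R : nzRingType) n (f l : 'I_n) : 'M[R]_n :=
  delta_mx f l + delta_mx l f.

Lemma edge_mx_sym (R : nzRingType) n (f l : 'I_n) :
  (edge_mx R f l)^T = edge_mx R f l.
Proof. by rewrite linearD /= !trmx_delta addrC. Qed.

Lemma mulmx_edge (R : nzRingType) n (A : 'M[R]_n) f l i j :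
  (A *m edge_mx R f l) i j = A i f *+ (j == l) + A i l *+ (j == f).
Proof.
have mul_delta a b : (A *m delta_mx a b) i j = A i a *+ (j == b).
  rewrite mxE (bigD1 a) //= big1 ?addr0 => [|s /negPf sN].
    by rewrite mxE eqxx mulr_natr.
  by rewrite mxE sN mulr0.
by rewrite mulmxDr mxE !mul_delta.
Qed.

(** The commutator with [edge_mx f l] only sees the rows and columns [f] and [l]
    of [A]: all the computations on the strong spectral property reduce to this
    formula. *)
Lemma commutator_edge (R : comNzRingType) n (A : 'M[R]_n) f l i j : A^T = A ->
  (A *m edge_mx R f l - edge_mx R f l *m A) i j =
  A i f *+ (j == l) + A i l *+ (j == f)
  - (A j f *+ (i == l) + A j l *+ (i == f)).
Proof.
move=> Asym; have -> : edge_mx R f l *m A = (A *m edge_mx R f l)^T.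
  by rewrite trmx_mul edge_mx_sym Asym.
by rewrite mxE [in X in _ + X]mxE [in X in - X]mxE !mulmx_edge.
Qed.

Lemma del_edge_completeE n (f l i j : 'I_n) : i != j ->
  del_edge (complete_graph n) [set f; l] i j =
  ~~ (((i == f) && (j == l)) || ((i == l) && (j == f))).
Proof.
move=> ij; rewrite /= /del_edge_rel /= /complete_rel ij /=; congr (~~ _).
apply/eqP/orP => [e|[]/andP[/eqP-> /eqP->] //]; last by rewrite setUC.
have : i \in [set f; l] by rewrite -e !inE eqxx.
have : j \in [set f; l] by rewrite -e !inE eqxx orbT.
rewrite !inE => /orP[]/eqP ej /orP[]/eqP ei; subst i j; rewrite !eqxx in ij *;
  by [|left|right].
Qed.

(** A witness [X] against the property can be nonzero only at the missing edge, so
    it is a multiple of [edge_mx f l], and the second differences of the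
    commutator [M] vanish. Comparing an inner vertex [i] with [f] gives
    [A i l - A i f = A l l - A f f]; as the rows [f] and [l] both sum to zero,
    this common difference is zero. Comparing two inner vertices then shows that
    [A i f] does not depend on [i]. *)
Lemma twin_of_not_SSPWL (R : realType) n (A : 'M[R]_n) (f l : 'I_n) :
  f != l ->
  weighted_laplacian (del_edge (complete_graph n) [set f; l]) A ->
  ~ has_SSPWL A ->
  exists alpha, forall i, i != f -> i != l ->
    A i f = - alpha /\ A i l = - alpha.
Proof.
move=> fl Alap notS; have [Asym Aneg Azero _] := Alap.
have rows i := laplacian_row_sum i Alap.
have Aswap i j : A i j = A j i by rewrite -[in RHS]Asym mxE.
have nadj : ~~ del_edge (complete_graph n) [set f; l] f l.
  by rewrite del_edge_completeE // !eqxx.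
have Afl : A f l = 0 by apply: Azero.
pose inner i := (i != f) && (i != l).
have [/forall_inP twin|/negP not_twin] := boolP [forall (i | inner i),
    [forall (j | inner j), (A i f == A j f) && (A i l == A j f)]].
  have [i0 i0in|no_inner] := pickP inner.
    exists (- A i0 f) => i i_f i_l; rewrite opprK.
    have i_in : inner i by rewrite /inner i_f.
    by have /andP[/eqP-> /eqP->] := forall_inP (twin i i_in) i0 i0in.
  by exists 0 => i i_f i_l; have := no_inner i; rewrite /inner i_f i_l.
case: notS => X Xsym AX0 IX0 HMH0.
have Xswap i j : X i j = X j i by rewrite -[in RHS]Xsym mxE.
set x := X f l.
have X_edge : X = x *: edge_mx R f l.
  apply/matrixP => i j; rewrite !mxE.
  have [<-|ij] := eqVneq i j.
    have := congr1 (fun Y : 'M_n => Y i i) IX0.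
    rewrite !mxE eqxx mul1r => ->.
    have /negPf ne : ~~ ((i == f) && (i == l)).
      by apply/negP => /andP[/eqP-> /eqP e]; rewrite e eqxx in fl.
    by rewrite ne andbC ne addr0 mulr0.
  have [|nedge] := boolP (((i == f) && (j == l)) || ((i == l) && (j == f))).
    case/orP => /andP[/eqP-> /eqP->];
      rewrite !eqxx (negPf fl) ?(eq_sym l) ?(negPf fl).
      by rewrite addr0 mulr1.
    by rewrite add0r mulr1 Xswap.
  have Aij : A i j < 0 by apply: Aneg; rewrite // del_edge_completeE.
  have := congr1 (fun Y : 'M_n => Y i j) AX0.
  rewrite !mxE => /eqP; rewrite mulf_eq0 (lt_eqF Aij) /= => /eqP ->.
  by case/norP: nedge => /negPf-> /negPf->; rewrite addr0 mulr0.
have [x0|x_neq0] := eqVneq x 0; first by rewrite X_edge x0 scale0r.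
case: not_twin.
pose M := A *m edge_mx R f l - edge_mx R f l *m A.
have contrast i i' j j' : M i j - M i' j = M i j' - M i' j'.
  apply: contrast_of_centering0; apply: (scalerI x_neq0).
  rewrite scaler0 -HMH0 X_edge -scalemxAr -scalemxAl -scalerBr.
  by rewrite -scalemxAr -scalemxAl.
have ME i j := commutator_edge f l i j Asym.
have lf : l != f by rewrite eq_sym.
have endpoint_diff i : inner i -> A i l - A i f = A l l - A f f.
  move=> /andP[/negPf i_f /negPf i_l].
  have := contrast i f f l; rewrite !ME.
  rewrite !eqxx i_f i_l (negPf fl) (negPf lf) ?(mulr0n, mulr1n); lra.
have diag_eq : A l l - A f f = 0.
  have := congr2 (fun u v => u - v) (rows l) (rows f).
  rewrite -sumrB (bigD1 f) //= (bigD1 l) //= (Aswap l f) Afl.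
  rewrite (eq_bigr (fun=> A l l - A f f)) => [|i i_in]; last first.
    by rewrite ![A _ i]Aswap endpoint_diff.
  (* One copy of the difference from each inner vertex, one more from [f, l]. *)
  rewrite sumr_const; set t := _ *+ _ => E.
  have : (A l l - A f f) *+ #|(fun i => (i != f) && (i != l))|.+1 = 0.
    by rewrite mulrS -/t; lra.
  by move/eqP; rewrite mulrn_eq0 => /eqP.
apply/forall_inP => i i_in; apply/forall_inP => j j_in; apply/andP.
have twin_i : A i l = A i f.
  by apply/eqP; rewrite -subr_eq0 endpoint_diff // diag_eq.
rewrite twin_i; suff -> : A i f = A j f by [].
have [-> //|ij] := eqVneq i j.
have := contrast i j j l; rewrite !ME.
move: i_in j_in => /andP[/negPf i_f /negPf i_l] /andP[/negPf j_f /negPf j_l].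
rewrite !eqxx i_f i_l j_f j_l (negPf lf) ?(mulr0n, mulr1n); lra.
Qed.

(** The witness is [edge_mx f l] itself: its commutator with [A] has the form
    [alpha (u 1^T - 1 u^T)], where [u] is the indicator of [f] and [l], and
    centering kills the all-ones vector. *)
Lemma not_SSPWL_of_twin (R : realType) n (A : 'M[R]_n) (f l : 'I_n) alpha :
  f != l ->
  weighted_laplacian (del_edge (complete_graph n) [set f; l]) A ->
  (forall i, i != f -> i != l -> A i f = - alpha /\ A i l = - alpha) ->
  ~ has_SSPWL A.
Proof.
move=> fl Alap twin S; have [Asym _ Azero _] := Alap.
have lf : l != f by rewrite eq_sym.
have n_gt0 : (0 < n)%N by apply: leq_trans (ltn_ord f).
have Aswap i j : A i j = A j i by rewrite -[in RHS]Asym mxE.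
have Afl : A f l = 0 by apply: Azero; rewrite // del_edge_completeE // !eqxx.
have diag_eq : A f f = A l l.
  have split i : A i f + (A i l + \sum_(j | (j != f) && (j != l)) A i j) = 0.
    rewrite -[RHS](laplacian_row_sum i Alap) [RHS](bigD1 f) //=.
    by rewrite [in RHS](bigD1 l).
  have := split f; have := split l; rewrite (Aswap l f) Afl.
  rewrite (eq_bigr (A f)) => [|i /andP[i_f i_l]]; first lra.
  by rewrite ![A _ i]Aswap; have [-> ->] := twin i i_f i_l.
pose u : 'cV[R]_n := delta_mx f 0 + delta_mx l 0.
have commutator_rank2 : A *m edge_mx R f l - edge_mx R f l *m A =
    alpha *: (u *m const_mx 1 - const_mx 1 *m u^T).
  apply/matrixP => i j; rewrite commutator_edge //.
  rewrite !mxE !big_ord1 !mxE !andbT mulr1 mul1r.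
  (* A name for the corner keeps the formula [Al] from rewriting its own output. *)
  pose a := A l l.
  have Af s : A s f = if s == f then a else if s == l then 0 else - alpha.
    have [-> //|s_f] := eqVneq s f; have [->|s_l] := eqVneq s l.
      by rewrite Aswap.
    by have [] := twin s s_f s_l.
  have Al s : A s l = if s == f then 0 else if s == l then a else - alpha.
    have [-> //|s_f] := eqVneq s f; have [-> //|s_l] := eqVneq s l.
    by have [] := twin s s_f s_l.
  rewrite !Af !Al; clearbody a.
  have [->|_] := eqVneq i f; have [->|_] := eqVneq j f; rewrite ?(negPf fl).
  - by rewrite !mulr0n; ring.
  - by case: (j == l); rewrite ?mulr0n ?mulr1n; ring.
  - by case: (i == l); rewrite ?mulr0n ?mulr1n; ring.
  - by case: (i == l); case: (j == l); rewrite ?mulr0n ?mulr1n; ring.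
have N0 : edge_mx R f l = 0.
  apply: S; first exact: edge_mx_sym.
  - apply/matrixP => i j; rewrite !mxE.
    have [/andP[/eqP-> /eqP->]|_] := boolP ((i == f) && (j == l)).
      by rewrite Afl mul0r.
    have [/andP[/eqP-> /eqP->]|_] := boolP ((i == l) && (j == f)).
      by rewrite Aswap Afl mul0r.
    by rewrite addr0 mulr0.
  - apply/matrixP => i j; rewrite !mxE; have [<-|_] := eqVneq i j; last first.
      by rewrite mul0r.
    have [->|_] := eqVneq i f; first by rewrite (negPf fl) addr0 mulr0.
    by rewrite andbF addr0 mulr0.
  have H1 := centering_ones R n_gt0.
  have oneH : const_mx 1 *m centering_mx R n = 0 :> 'rV_n.
    by apply: trmx_inj; rewrite trmx_mul centering_tr trmx_const H1 trmx0.
  rewrite commutator_rank2; move: (centering_mx R n) H1 oneH => H H1 oneH.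
  rewrite -scalemxAr -scalemxAl mulmxBr mulmxBl.
  by rewrite -!mulmxA oneH !mulmx0 sub0r mulmxA H1 mul0mx oppr0 scaler0.
have := congr1 (fun Y : 'M_n => Y f l) N0.
by rewrite !mxE !eqxx (negPf fl) addr0 => /eqP; rewrite oner_eq0.
Qed.

(** * The block form *)

Definition vfirst k : 'I_(1 + (k + 1)) := lshift (k + 1) ord0.

Definition vlast k : 'I_(1 + (k + 1)) := rshift 1 (rshift k ord0).

Definition vmid k (i : 'I_k) : 'I_(1 + (k + 1)) := rshift 1 (lshift 1 i).

Lemma vfirst_neq_vlast k : vfirst k != vlast k.
Proof. by rewrite -val_eqE. Qed.

Lemma vmid_neq_vfirst k (i : 'I_k) : vmid i != vfirst k.
Proof. by rewrite -val_eqE. Qed.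

Lemma vmid_neq_vlast k (i : 'I_k) : vmid i != vlast k.
Proof. by rewrite -val_eqE /= eqSS addn0 neq_ltn ltn_ord. Qed.

Variant vertex_spec k : 'I_(1 + (k + 1)) -> Type :=
  | VertexFirst : vertex_spec (vfirst k)
  | VertexMid i : vertex_spec (vmid i)
  | VertexLast : vertex_spec (vlast k).

Lemma vertexP k (i : 'I_(1 + (k + 1))) : vertex_spec i.
Proof.
have [i' ->|i' ->] := split_ordP i; first by rewrite ord1; constructor.
by have [j ->|j ->] := split_ordP i'; rewrite ?ord1; constructor.
Qed.

Lemma first_last_border k : first_last (1 + (k + 1)) = [set vfirst k; vlast k].
Proof.
apply/setP => i; rewrite !inE -!val_eqE /=; congr (_ || (_ == _)).
by rewrite addn0 add0n addnC.
Qed.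

Lemma sum_border (V : nmodType) k (F : 'I_(1 + (k + 1)) -> V) :
  \sum_i F i = F (vfirst k) + (\sum_i F (vmid i) + F (vlast k)).
Proof. by rewrite big_split_ord big_ord1 big_split_ord big_ord1. Qed.

Section BorderedEntries.
Variables (R : realType) (k : nat) (B : 'M[R]_k) (alpha : R).
Local Notation A := (bordered_block B alpha).

Lemma bordered_ff : A (vfirst k) (vfirst k) = k%:R * alpha.
Proof. by rewrite block_mxEul !mxE eqxx mulr1n. Qed.

Lemma bordered_fm j : A (vfirst k) (vmid j) = - alpha.
Proof. by rewrite block_mxEur row_mxEl !mxE mulr1. Qed.

Lemma bordered_fl : A (vfirst k) (vlast k) = 0.
Proof. by rewrite block_mxEur row_mxEr !mxE. Qed.

Lemma bordered_mf i : A (vmid i) (vfirst k) = - alpha.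
Proof. by rewrite block_mxEdl col_mxEu !mxE mulr1. Qed.

Lemma bordered_mm i j : A (vmid i) (vmid j) = B i j + (2 * alpha) *+ (i == j).
Proof. by rewrite block_mxEdr block_mxEul !mxE. Qed.

Lemma bordered_ml i : A (vmid i) (vlast k) = - alpha.
Proof. by rewrite block_mxEdr block_mxEur !mxE mulr1. Qed.

Lemma bordered_lf : A (vlast k) (vfirst k) = 0.
Proof. by rewrite block_mxEdl col_mxEd !mxE. Qed.

Lemma bordered_lm j : A (vlast k) (vmid j) = - alpha.
Proof. by rewrite block_mxEdr block_mxEdl !mxE mulr1. Qed.

Lemma bordered_ll : A (vlast k) (vlast k) = k%:R * alpha.
Proof. by rewrite block_mxEdr block_mxEdr !mxE eqxx mulr1n. Qed.

End BorderedEntries.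

Definition bordered_entries := (bordered_ff, bordered_fm, bordered_fl,
  bordered_mf, bordered_mm, bordered_ml, bordered_lf, bordered_lm, bordered_ll).

(** The corner entries of [A] and the row sums of the middle block are forced by
    the vanishing of the row sums of [A]. *)
Lemma bordered_of_twin (R : realType) k (A : 'M[R]_(1 + (k + 1))) alpha :
  weighted_laplacian
    (del_edge (complete_graph _) (first_last (1 + (k + 1)))) A ->
  (forall i, i != vfirst k -> i != vlast k ->
     A i (vfirst k) = - alpha /\ A i (vlast k) = - alpha) ->
  exists B : 'M[R]_k,
    weighted_laplacian (complete_graph k) B /\ A = bordered_block B alpha.
Proof.
rewrite first_last_border => Alap twin; have [Asym Aneg Azero _] := Alap.
have Aswap i j : A i j = A j i by rewrite -[in RHS]Asym mxE.
have Amf i : A (vmid i) (vfirst k) = - alpha.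
  by have [] := twin _ (vmid_neq_vfirst i) (vmid_neq_vlast i).
have Aml i : A (vmid i) (vlast k) = - alpha.
  by have [] := twin _ (vmid_neq_vfirst i) (vmid_neq_vlast i).
have fl := vfirst_neq_vlast k.
have Afl : A (vfirst k) (vlast k) = 0.
  by apply: Azero; rewrite // del_edge_completeE // !eqxx.
have rows i := laplacian_row_sum i Alap.
have sum_twin : \sum_(i < k) - alpha = - (k%:R * alpha).
  by rewrite sumr_const card_ord mulNrn mulr_natl.
have Aff : A (vfirst k) (vfirst k) = k%:R * alpha.
  have := rows (vfirst k); rewrite sum_border Afl addr0.
  rewrite (eq_bigr (fun=> - alpha)) => [|i _]; last by rewrite Aswap.
  by rewrite sum_twin => /eqP; rewrite subr_eq0 => /eqP.
have All : A (vlast k) (vlast k) = k%:R * alpha.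
  have := rows (vlast k); rewrite sum_border Aswap Afl add0r.
  rewrite (eq_bigr (fun=> - alpha)) => [|i _]; last by rewrite Aswap.
  by rewrite sum_twin addrC => /eqP; rewrite subr_eq0 => /eqP.
exists (\matrix_(i, j) (A (vmid i) (vmid j) - (2 * alpha) *+ (i == j))).
split; last first.
  apply/matrixP => i j.
  case: (vertexP i) => [|{}i|]; case: (vertexP j) => [|{}j|];
    rewrite bordered_entries ?mxE ?subrK ?Aff ?All ?Afl ?Amf ?Aml //.
  - by rewrite Aswap.
  - by rewrite Aswap.
  - by rewrite Aswap.
apply: laplacian_of_row_sums.
- by apply/matrixP => i j; rewrite !mxE Aswap eq_sym.
- move=> i j ij; rewrite mxE (negPf ij) subr0.
  have mij : vmid i != vmid j by rewrite -val_eqE /= eqSS.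
  apply: Aneg => //; rewrite del_edge_completeE //.
  by rewrite (negPf (vmid_neq_vfirst i)) (negPf (vmid_neq_vlast i)).
- move=> i; under eq_bigr do rewrite mxE.
  rewrite sumrB [X in _ - X](bigD1 i) //= eqxx.
  rewrite [X in _ - (_ + X)]big1 => [|j /negPf ji]; last by rewrite eq_sym ji.
  have := rows (vmid i); rewrite sum_border Amf Aml mulr1n addr0 => E.
  by rewrite -[RHS]E; ring.
Qed.

(** An inner vertex is needed to see that [alpha] is positive, whence [k.+1]. *)
Lemma not_SSPWL_bordered (R : realType) k (A : 'M[R]_(1 + (k.+1 + 1))) :
  weighted_laplacian
    (del_edge (complete_graph _) (first_last (1 + (k.+1 + 1)))) A ->
  ~ has_SSPWL A <->
  exists (B : 'M[R]_k.+1) (alpha : R),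
    [/\ weighted_laplacian (complete_graph k.+1) B, 0 < alpha
      & A = bordered_block B alpha].
Proof.
move=> Alap; have := Alap; rewrite first_last_border => Alap'.
split=> [notS|[B [alpha [_ alpha_gt0 defA]]]].
  have [alpha twin] := twin_of_not_SSPWL (vfirst_neq_vlast _) Alap' notS.
  have [B [Blap defA]] := bordered_of_twin Alap twin.
  exists B, alpha; split=> //.
  have [_ Aneg _ _] := Alap'.
  have ord0f := vmid_neq_vfirst (ord0 : 'I_k.+1).
  have := Aneg _ _ ord0f; rewrite del_edge_completeE //.
  rewrite (negPf ord0f) (negPf (vmid_neq_vlast _)) defA bordered_entries.
  by rewrite oppr_lt0; apply.
apply: (not_SSPWL_of_twin (vfirst_neq_vlast _) Alap' (alpha := alpha)) => i.
by case: (vertexP i) => [|{}i|]; rewrite ?eqxx // defA !bordered_entries.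
Qed.

Theorem theorem4p2 (R : realType) (n : nat) (n_ge3 : (3 <= n)%N) (A : 'M[R]_n)
    (A_lap : weighted_laplacian
               (del_edge (complete_graph n) (first_last n)) A) :
  (~ has_SSPWL A <->
     exists (B : 'M[R]_(n - 2)) (alpha : R),
       [/\ weighted_laplacian (complete_graph (n - 2)) B, 0 < alpha
         & A = bordered_mx n_ge3 B alpha]) /\
  (forall (B : 'M[R]_(n - 2)) (alpha : R),
     weighted_laplacian (complete_graph (n - 2)) B -> 0 < alpha ->
     A = bordered_mx n_ge3 B alpha ->
     (exists mu : (n - 3).-tuple R, is_spec B (0 :: mu)) /\
     (forall mu : (n - 3).-tuple R, is_spec B (0 :: mu) ->
        is_spec A [:: 0, (n - 2)%:R * alpha, n%:R * alpha
                     & [seq m + 2 * alpha | m <- mu]])).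
Proof.
rewrite /bordered_mx; move: (bordered_dim n_ge3) => dim.
have k_gt0 : (0 < n - 2)%N by rewrite subn_gt0.
have pred_k : (n - 3).+1 = (n - 2)%N by rewrite -subSn.
have n_k : n = (n - 2).+2 by rewrite -addn2 subnK // ltnW.
split.
  (* Once [n - 2] is an independent [k.+1], the cast is along reflexivity. *)
  move: (n - 2)%N k_gt0 dim => [//|k] _ dim; move: A A_lap.
  by case: _ / dim => A A_lap; apply: not_SSPWL_bordered.
move=> B alpha Blap _ ->; split; first exact: laplacian_spec pred_k Blap.
move=> mu specB; have -> : n%:R = (n - 2).+2%:R :> R by rewrite -n_k.
have := spec_bordered_block alpha (laplacian_ones Blap) specB.
move: (bordered_block B alpha) => C; rewrite /is_spec => <-.
have char_poly_cast m (e : (1 + ((n - 2) + 1) = m)%N) :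
    char_poly (castmx (e, e) C) = char_poly C.
  by case: _ / e; rewrite castmx_id.
exact: char_poly_cast.
Qed.
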